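(* Let $k$ be an arbitrary field, let $1\leq m\leq n$ and let $\mathbf{X}=(x_{i,j})$ be an $m\times n$ generic matrix over $k$. Let $\Theta(n,m)$ denote the Jacobian matrix of the $m$-minors of $\mathbf{X}$ with respect to the variables $x_{i,j}$, and let $G(n,m)$ be the Grassmann algebra of size $(n,m)$. Then $\operatorname{rank}\Theta(n,m)=\dim G(n,m)$.
   Context: A generic matrix is one whose entries are independent indeterminates over $k$; $k[\mathbf{X}]$ is the polynomial ring in these entries. The Grassmann algebra $G(n,m)$ is the $k$-subalgebra of $k[\mathbf{X}]$ generated by the $m$-minors of $\mathbf{X}$, and $\dim$ is Krull dimension. The rank of a matrix over $k[\mathbf{X}]$ is its rank over the fraction field of $k[\mathbf{X}]$. *)

(* Defs.v *)
From HB Require Import structures.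
From mathcomp Require Import all_boot all_order all_algebra.
From mathcomp Require Import ring_quotient mpoly.
From mathcomp Require boolp.

Set Implicit Arguments.
Unset Strict Implicit.
Unset Printing Implicit Defensive.

Import GRing.Theory.
Local Open Scope ring_scope.

Section GeneratedSubalgebra.

Variables (R : comNzRingType) (A : comAlgType R).

(* The intersection of all subalgebras containing S. Membership is made boolean
   by excluded middle, so that the subtype below inherits its ring structure. *)
Definition gen_subalg (S : {pred A}) : {pred A} :=
  [pred x | boolp.asbool (forall B : {pred A},
                            subalg_closed B -> {subset S <= B} -> x \in B)].

Lemma gen_subalgP (S : {pred A}) x :
  reflect (forall B : {pred A}, subalg_closed B -> {subset S <= B} -> x \in B)
          (x \in gen_subalg S).
Proof. exact: boolp.asboolP. Qed.

Lemma sub_gen_subalg (S : {pred A}) : {subset S <= gen_subalg S}.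
Proof. by move=> x Sx; apply/gen_subalgP => B _; apply. Qed.

Lemma gen_subalg_closed (S : {pred A}) : subalg_closed (gen_subalg S).
Proof.
split.
- by apply/gen_subalgP => B [].
- move=> a x y /gen_subalgP Gx /gen_subalgP Gy.
  by apply/gen_subalgP => B cB sB; have [_ + _] := cB; apply; auto.
- move=> x y /gen_subalgP Gx /gen_subalgP Gy.
  by apply/gen_subalgP => B cB sB; have [_ _ +] := cB; apply; auto.
Qed.

HB.instance Definition _ (S : {pred A}) :=
  GRing.isSubringClosed.Build A (gen_subalg S)
    (gen_subalg_closed S).

Record gen_subalg_of (S : {pred A}) :=
  GenSubalg { gen_subalg_val :> A; _ : gen_subalg_val \in gen_subalg S }.

HB.instance Definition _ (S : {pred A}) :=
  [isSub for @gen_subalg_val S].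
HB.instance Definition _ (S : {pred A}) :=
  [Choice of gen_subalg_of S by <:].
HB.instance Definition _ (S : {pred A}) :=
  [SubChoice_isSubComNzRing of gen_subalg_of S by <:].

End GeneratedSubalgebra.

Section KrullDimension.

Variable R : comNzRingType.

(* P_0 < P_1 < ... < P_l, a chain of length l; ideals in [prime_idealr] are
   proper. *)
Definition prime_chain (l : nat) (P : 'I_l.+1 -> prime_idealr R) : Prop :=
  forall i j : 'I_l.+1, (i < j)%N ->
    {subset P i <= P j} /\ (exists2 x, x \in P j & x \notin P i).

Definition has_krull_dim (d : nat) : Prop :=
  (exists P : 'I_d.+1 -> prime_idealr R, prime_chain P) /\
  (forall (l : nat) (P : 'I_l.+1 -> prime_idealr R), prime_chain P -> (l <= d)%N).

End KrullDimension.

Section Grassmann.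

Variables (k : fieldType) (n m : nat).

Definition generic_mx : 'M[{mpoly k[m * n]}]_(m, n) :=
  \matrix_(i < m, j < n) 'X_(mxvec_index i j).

(* Column selections of the m-minors: j_0 < ... < j_(m-1). *)
Definition col_sel : {set m.-tuple 'I_n} :=
  [set t : m.-tuple 'I_n | sorted ltn (map val t)].

Definition minor (t : m.-tuple 'I_n) : {mpoly k[m * n]} :=
  \det (colsub (tnth t) generic_mx).

Definition jacobian_minors : 'M[{mpoly k[m * n]}]_(#|col_sel|, m * n) :=
  \matrix_(s < #|col_sel|, v < m * n) (minor (enum_val s))^`M(v).

Definition grassmann_algebra : comNzRingType :=
  gen_subalg_of [pred p | p \in [seq minor t | t in col_sel]].

End Grassmann.

(* Main.v *)
Require Import Defs.
From HB Require Import structures.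
From mathcomp Require Import all_boot all_order all_algebra.
From mathcomp Require Import mpoly.
From mathcomp Require Import perm ring_quotient zify.

(** Write [n = m + q] and let [G] be the Grassmann algebra. Both the rank of the
Jacobian matrix and the Krull dimension of [G] are shown to be [m * q + 1], over
any field. Each is computed on its own, because in positive characteristic a
Jacobian matrix can have rank below the transcendence degree.

Rank. Minors are multiplied by [\det E] under [X |-> E *m X], so infinitesimally
the direction [E *m X] changes every minor by the factor [\tr E]
([jacobian_mul_row_operations]). As [X] has full row rank, these directions
span a space of dimension [m ^ 2], on which the Jacobian has rank at most one;
the Frobenius inequality gives [\rank <= m * n - m ^ 2 + 1]
([rank_jacobian_le]).
Conversely, at the point [(1 | 0)] the first maximal minor and the [m * q]
minors obtained from it by exchanging one column have a diagonal matrix of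
partial derivatives with respect to suitable variables ([rank_jacobian_ge]).

Dimension from above. Every minor of [X = (A | B)] is [\det A] times a minor of
[(1 | A^-1 B)], so [G] embeds into a polynomial ring in [m * q + 1] variables
([embed_inj]). A chain of [l + 1] primes [P_0 < ... < P_l] in an algebra yields
elements [x_i] of [P_(i+1)] outside [P_i], and the monomials in the [x_i] with
exponents below [N] are linearly independent ([prime_chain_growth]). These are
[N ^ l] polynomials of degree [O(N)] in [D] variables, whence [l <= D]
([prime_chain_subpolynomial]).

Dimension from below. Setting to zero the entries of [X] left of a staircase
defines a homomorphism from [G] to a domain. Moving the staircase one cell at a
time to the right, until all maximal minors vanish, gives [m * q + 2] nested
kernels; the minor on the corners of a staircase is a product of variables
there, and vanishes at the next one ([schubert_chain]). These kernels are the
ideals of Schubert varieties, followed by the irrelevant ideal. *)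

Set Implicit Arguments.
Unset Strict Implicit.
Unset Printing Implicit Defensive.

Import GRing.Theory.
Local Open Scope ring_scope.

(** * Prime chains and growth *)

Section PrimeChainGrowth.

Variables (k : fieldType) (A : comNzRingType) (h : {rmorphism k -> A}).

Definition indep_mod (P : prime_idealr A) (I : finType) (f : I -> A) : Prop :=
  forall c : I -> k, \sum_i h (c i) * f i \in P -> forall i, c i = 0.

Lemma indep_mod1 (P : prime_idealr A) : indep_mod P (fun _ : unit => 1).
Proof.
move=> c; rewrite (big_pred1 tt) => [|[]//]; rewrite mulr1 => Pc [].
apply/eqP; apply: contraFT (idealr1 P) => c0.
by rewrite -(rmorph1 h) -(mulVf c0) rmorphM idealMr.
Qed.

(** Take a combination of the [x ^+ i * f j] in [P] and let [e] be the least
power of [x] that occurs. Since [P] is prime and omits [x], the factor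
[x ^+ e] can be cancelled; modulo [Q] only the terms with [i = e] survive. *)
Lemma indep_mod_powers (P Q : prime_idealr A) (x : A) (N : nat)
    (I : finType) (f : I -> A) :
  {subset P <= Q} -> x \in Q -> x \notin P -> indep_mod Q f ->
  indep_mod P (fun u : 'I_N * I => x ^+ u.1 * f u.2).
Proof.
move=> sPQ Qx Px indf c Pc.
pose g (i : 'I_N) := \sum_j h (c (i, j)) * f j.
have {}Pc : \sum_(i < N) x ^+ i * g i \in P.
  congr (_ \in P): Pc; under [RHS]eq_bigr do rewrite mulr_sumr.
  by rewrite pair_bigA; apply: eq_bigr => -[i j] _; rewrite mulrCA.
(* The coefficients vanish by induction on the power of [x] they multiply. *)
suff low (e : nat) (i : 'I_N) j : (i < e)%N -> c (i, j) = 0.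
  by case=> i j; apply: (low N).
elim: e => // e IHe in i j *.
rewrite ltnS leq_eqVlt => /orP[/eqP ie|]; last exact: IHe.
suff Qg : g i \in Q by apply: (indf (fun j => c (i, j))).
have: \sum_(a < N | (e <= a)%N) x ^+ (a - e) * g a \in P.
  have: x ^+ e * \sum_(a < N | (e <= a)%N) x ^+ (a - e) * g a \in P.
    rewrite mulr_sumr; congr (_ \in P): Pc.
    rewrite (bigID (fun a : 'I_N => (e <= a)%N)) /= [X in _ + X]big1 ?addr0.
      by apply: eq_bigr => a lea; rewrite mulrA -exprD subnKC.
    move=> a; rewrite -ltnNge => ltae.
    by rewrite /g big1 ?mulr0 // => b _; rewrite (IHe _ _ ltae) rmorph0 mul0r.
  rewrite prime_idealrM => /orP[xeP|//]; case/negP: Px.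
  elim: (e) xeP => [|d IHd]; first by rewrite expr0 idealr1.
  by rewrite exprS prime_idealrM => /orP[].
move/sPQ; rewrite (bigD1 i) ?ie //= subnn expr0 mul1r rpredDr //.
apply: rpred_sum => a /andP[lea neqa].
have /subnSK <-: (e < a)%N by rewrite ltn_neqAle lea andbT -ie eq_sym.
by rewrite exprS -mulrA mulrC idealMr.
Qed.

(** The witnesses are the monomials with exponents below [N] in elements
separating consecutive primes. The constant [C] does not depend on [N]: it is
the sum of the degrees of these elements. *)
Lemma prime_chain_growth (deg : A -> nat) (l : nat)
    (P : 'I_l.+1 -> prime_idealr A) :
  deg 1 = 0%N -> (forall x y, (deg (x * y)%R <= deg x + deg y)%N) ->
  prime_chain P ->
  exists C, forall N, exists (I : finType) (f : I -> A),
    [/\ #|I| = (N ^ l)%N, forall i, (deg (f i) <= C * N)%N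
      & indep_mod (P ord0) f].
Proof.
move=> deg1 degM; elim: l => [|l IHl] in P *.
  move=> _; exists 0%N => N; exists unit, (fun=> 1); split=> [|_|].
  - by rewrite card_unit.
  - by rewrite deg1.
  - exact: indep_mod1.
move=> chP; case: (IHl (fun i => P (lift ord0 i))) => [i j ij|C HC].
  by apply: chP.
case: (chP ord0 (lift ord0 ord0)) => // sub [x xQ xP].
exists (deg x + C)%N => N; have [I [f [cI dI If]]] := HC N.
exists ('I_N * I)%type, (fun u : 'I_N * I => x ^+ u.1 * f u.2); split=> [|u|].
- by rewrite card_prod card_ord cI expnS.
- apply: leq_trans (degM _ _) _; rewrite mulnDl leq_add //.
  have degX e : (deg (x ^+ e)%R <= deg x * e)%N.
    elim: e => [|e IHe]; first by rewrite expr0 deg1.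
    by rewrite exprS mulnS (leq_trans (degM _ _)) // leq_add2l.
  by rewrite (leq_trans (degX _)) // leq_mul2l ltnW ?orbT.
- exact: indep_mod_powers If.
Qed.

End PrimeChainGrowth.

Lemma card_bounded_monomials (D b : nat) : (#|{: 'X_{1..D < b}}| <= b ^ D)%N.
Proof.
have -> : (b ^ D)%N = #|{ffun 'I_D -> 'I_b}| by rewrite card_ffun !card_ord.
have lt (u : 'X_{1..D < b}) i : (bmnm u i < b)%N.
  by rewrite (leq_ltn_trans _ (bmdeg u)) // mdegE (bigD1 i) //= leq_addr.
apply: (leq_card (fun u => [ffun i => Ordinal (lt u i)])) => u v /ffunP uv.
by apply/val_inj/mnmP => i; have := congr1 val (uv i); rewrite !ffunE.
Qed.

Lemma free_bounded_degree (k : fieldType) (D b : nat) (I : finType)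
    (p : I -> {mpoly k[D]}) :
  (forall i, (msize (p i) <= b)%N) ->
  (forall c : I -> k, \sum_i c i *: p i = 0 -> forall i, c i = 0) ->
  (#|I| <= b ^ D)%N.
Proof.
move=> szp freep; apply: leq_trans (card_bounded_monomials D b).
pose M := \matrix_(i < #|I|, u < #|{: 'X_{1..D < b}}|)
            (p (enum_val i))@_(enum_val u).
suff /eqP <- : row_free M by apply: rank_leq_col.
apply: inj_row_free => v vM0; apply/rowP => i; rewrite mxE -(enum_valK i).
apply: (freep (fun j => v 0 (enum_rank j))); apply/mpolyP => u.
rewrite raddf_sum mcoeff0 /=.
have [ltu|leu] := ltnP (mdeg u) b.
  have /rowP/(_ (enum_rank (BMultinom ltu))) := vM0.
  rewrite !mxE => {2}<-; rewrite (reindex_onto enum_val enum_rank) /=; last first.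
    by move=> j _; rewrite enum_rankK.
  under eq_bigl do rewrite enum_valK eqxx.
  by apply: eq_bigr => j _; rewrite mcoeffZ !mxE enum_valK enum_rankK.
apply: big1 => j _; rewrite mcoeffZ memN_msupp_eq0 ?mulr0 //.
by apply/negP => /msize_mdeg_lt /leq_trans/(_ (szp j)); rewrite ltnNge leu.
Qed.

(** If [D < l], then [N ^ D.+1 <= (C.+1) ^ D * N ^ D], which fails as soon as [N]
exceeds [C.+1 ^ D]. *)
Lemma exponent_le_of_growth (l D C : nat) :
  (forall N, (N ^ l <= (C * N).+1 ^ D)%N) -> (l <= D)%N.
Proof.
move=> H; rewrite leqNgt; apply/negP => ltDl.
pose N := (C.+1 ^ D).+1; have N0 : (0 < N)%N by [].
suff: (N ^ D.+1 <= C.+1 ^ D * N ^ D)%N.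
  by rewrite expnS leq_pmul2r ?expn_gt0 ?N0 // ltnn.
apply: leq_trans (_ : N ^ l <= _)%N; first by rewrite leq_pexp2l.
apply: leq_trans (H N) _; rewrite -expnMn.
by case: (D) => // d; rewrite leq_exp2r //; nia.
Qed.

(** The Krull dimension of a subalgebra of a polynomial ring is at most the number
of variables; the total degree of the ambient ring measures the growth. *)
Lemma prime_chain_subpolynomial (k : fieldType) (A : comNzRingType) (D : nat)
    (h : {rmorphism k -> A}) (phi : {rmorphism A -> {mpoly k[D]}})
    (l : nat) (P : 'I_l.+1 -> prime_idealr A) :
  injective phi -> (forall c, phi (h c) = c%:MP) -> prime_chain P -> (l <= D)%N.
Proof.
move=> injphi phih chP; pose deg x := (msize (phi x)).-1.
have deg1 : deg 1 = 0%N by rewrite /deg rmorph1 msize1.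
have degM x y : (deg (x * y)%R <= deg x + deg y)%N.
  rewrite /deg rmorphM.
  have [->|p0] := eqVneq (phi x) 0; first by rewrite mul0r msize0.
  have [->|q0] := eqVneq (phi y) 0; first by rewrite mulr0 msize0.
  by rewrite msizeM // (mpolySpred _ p0) (mpolySpred _ q0) addnS.
have [C HC] := prime_chain_growth h deg1 degM chP.
apply: (@exponent_le_of_growth _ _ C) => N.
have [I [f [<- degf indf]]] := HC N.
apply: (free_bounded_degree (p := phi \o f)) => [i|c].
  by have := degf i; rewrite /deg /=; lia.
rewrite (_ : \sum_i _ = phi (\sum_i h (c i) * f i)); last first.
  by rewrite rmorph_sum; apply: eq_bigr => i _; rewrite rmorphM /= phih mul_mpolyC.
rewrite -(rmorph0 phi) => /injphi c0; apply: indf; rewrite c0; exact: idealr0.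
Qed.

(** * Specializing and differentiating minors *)

Lemma col_sel_ltn (n m : nat) (t : m.-tuple 'I_n) :
  (forall c d : 'I_m, (c < d)%N -> (tnth t c < tnth t d)%N) -> t \in col_sel n m.
Proof.
move=> tP; rewrite inE; apply/(sortedP 0%N) => i; rewrite size_map size_tuple => lti.
have x0 := tnth t (Ordinal lti).
rewrite !(nth_map x0) ?size_tuple ?(ltnW lti) //.
by have := tP (Ordinal (ltnW lti)) (Ordinal lti) (ltnSn _); rewrite !(tnth_nth x0).
Qed.

Section Specialization.

Variables (k : fieldType) (n m : nat) (S : comNzRingType).
Variables (f : {rmorphism k -> S}) (M : 'M[S]_(m, n)).

(** The evaluation of polynomials at [X := M], with [f] acting on constants. *)
Definition specialize : {mpoly k[m * n]} -> S := mmap f (mxvec M 0).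

HB.instance Definition _ := GRing.RMorphism.on specialize.

Lemma specialize_generic : map_mx specialize (generic_mx k n m) = M.
Proof. by apply/matrixP => i j; rewrite !mxE /specialize mmapX mmap1U mxvecE. Qed.

Lemma specialize_minor t : specialize (minor k t) = \det (colsub (tnth t) M).
Proof. by rewrite -det_map_mx map_mxsub specialize_generic. Qed.

Lemma specializeC c : specialize c%:MP = f c.
Proof. exact: mmapC. Qed.

End Specialization.

Lemma mderiv_det_eq0 (k : fieldType) (N p : nat) (M : 'M[{mpoly k[N]}]_p) v :
  (forall i j, (M i j)^`M(v) = 0) -> (\det M)^`M(v) = 0.
Proof.
move=> M0; rewrite raddf_sum /= big1 // => s _.
have prod0 : (\prod_i M i (s i))^`M(v) = 0.
  elim/big_ind: _ => [|x y x0 y0|//]; first by rewrite -mpolyC1 mderivC.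
  by rewrite mderivM x0 y0 mul0r mulr0 addr0.
by case: (odd_perm s); rewrite ?mulN1r ?mul1r ?mderivN prod0 ?oppr0.
Qed.

Lemma lin_mulmxrE (R : comNzRingType) m n p (B : 'M[R]_(n, p)) a b i j :
  lin_mulmxr B (mxvec_index a b) (mxvec_index i j) = (i == a :> 'I_m)%:R * B b j.
Proof.
transitivity (mxvec (delta_mx a b *m B) 0 (mxvec_index i j)).
  by rewrite -(mul_vec_lin (mulmxr B)) mxvec_delta -rowE [RHS]mxE.
rewrite mxvecE mxE (bigD1 b) //= big1 ?addr0 => [|c neq]; rewrite mxE.
  by rewrite eqxx andbT.
by rewrite (negPf neq) andbF mul0r.
Qed.

Section Jacobian.

Variables (k : fieldType) (n m : nat).
Local Notation X := (generic_mx k n m).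

Lemma mderiv_generic i j a b :
  (X i j)^`M(mxvec_index a b) = ((i == a) && (j == b))%:R.
Proof.
have inj_idx: injective (uncurry (@mxvec_index m n)).
  by move=> [i1 j1] [i2 j2] /cast_ord_inj/enum_rank_inj.
rewrite mxE mderivX mnm1E (inj_eq inj_idx (i, j) (a, b)) xpair_eqE.
case: andP => [[/eqP-> /eqP->]|_]; last by rewrite scale0r.
by rewrite scale1r -{1}[U_(_)%MM]addm0 addmC addmK mpolyX0.
Qed.

(** In the expansion along row [a], only the entries of that row depend on the
variables of row [a]. *)
Lemma mderiv_minor (t : m.-tuple 'I_n) a b :
  (minor k t)^`M(mxvec_index a b) =
  \sum_(c | tnth t c == b) cofactor (colsub (tnth t) X) a c.
Proof.
rewrite /minor (expand_det_row _ a) raddf_sum [RHS]big_mkcond /=.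
apply: eq_bigr => c _.
rewrite mderivM [X in _ + _ * X](_ : _ = 0) ?mulr0 ?addr0; last first.
  have det0 : (\det (row' a (col' c (colsub (tnth t) X))))^`M(mxvec_index a b) = 0.
    apply: mderiv_det_eq0 => i j.
    have -> : row' a (col' c (colsub (tnth t) X)) i j
              = X (lift a i) (tnth t (lift c j)) by rewrite !mxE.
    by rewrite mderiv_generic eq_sym (negPf (neq_lift _ _)).
  rewrite /cofactor -signr_odd.
  by case: (odd _); rewrite ?mulN1r ?mul1r ?mderivN det0 ?oppr0.
rewrite mxE mderiv_generic eqxx /=.
by case: eqP; rewrite ?mul1r ?mul0r.
Qed.

Lemma sum_mxvec_index (R : nmodType) (F : 'I_(m * n) -> R) :
  \sum_w F w = \sum_i \sum_j F (mxvec_index i j).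
Proof.
rewrite pair_bigA (reindex (uncurry (@mxvec_index m n))) /=.
  by apply: eq_bigr => -[].
exact: curry_mxvec_bij.
Qed.

(** The row of [lin_mulmxr X] with index [(a, b)] is the direction
[delta_mx a b *m X], in which row [b] of [X] is added to row [a]. By the
cofactor expansion with alien cofactors this fixes the minors to first order
when [a != b], and scales them when [a = b]. *)
Lemma jacobian_mul_row_operations :
  jacobian_minors k n m *m (lin_mulmxr X)^T =
  (\col_s minor k (enum_val s)) *m mxvec 1%:M.
Proof.
apply/matrixP => s v; case/mxvec_indexP: v => a b.
rewrite mxE [RHS]mxE big_ord1 [(\col__ _) _ _]mxE mxvecE.
rewrite [1%:M _ _]mxE sum_mxvec_index.
set t := enum_val s; set M := colsub (tnth t) X.
transitivity ((M *m \adj M) b a); last by rewrite mul_mx_adj !mxE eq_sym mulr_natr.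
rewrite (bigD1 a) //= [X in _ + X]big1 ?addr0; last first.
  move=> i neq; apply: big1 => j _.
  by rewrite [_^T _ _]mxE lin_mulmxrE (negPf neq) mul0r mulr0.
rewrite mxE [RHS](partition_big (tnth t) xpredT) //=; apply: eq_bigr => j _.
rewrite [_^T _ _]mxE lin_mulmxrE eqxx mul1r.
rewrite [jacobian_minors _ _ _ _ _]mxE mderiv_minor mulr_suml.
by apply: eq_bigr => c /eqP <-; rewrite [\adj _ _ _]mxE [M b c]mxE mulrC.
Qed.

End Jacobian.

(** * The rank of the Jacobian matrix *)

Lemma rank_mxsub_le (F : fieldType) p q a b (r : 'I_a -> 'I_p) (c : 'I_b -> 'I_q)
    (M : 'M[F]_(p, q)) :
  (\rank (mxsub r c M) <= \rank M)%N.
Proof.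
have rowle p' q' a' (r' : 'I_a' -> 'I_p') (N : 'M[F]_(p', q')) :
  (\rank (rowsub r' N) <= \rank N)%N by apply/mxrankS/rowsub_sub.
have -> : mxsub r c M = rowsub r (rowsub c M^T)^T.
  by apply/matrixP=> i j; rewrite !mxE.
by apply: leq_trans (rowle _ _ _ _ _) _; rewrite mxrank_tr -[leqRHS]mxrank_tr.
Qed.

(** A minor that is nonzero after specialization is nonzero, so the rank can only
drop under specialization. *)
Lemma rank_ge_diagonal_specialization (R : idomainType) (K : fieldType)
    (ev : {rmorphism R -> K}) p q (J : 'M[R]_(p, q)) (I : finType)
    (r : I -> 'I_p) (c : I -> 'I_q) :
  (forall i, ev (J (r i) (c i)) != 0) ->
  (forall i j, i != j -> ev (J (r i) (c j)) = 0) ->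
  (#|I| <= \rank (map_mx (@tofrac R) J))%N.
Proof.
move=> diag0 off0; pose r' (i : 'I_#|I|) := r (enum_val i).
pose c' (i : 'I_#|I|) := c (enum_val i); pose S := mxsub r' c' J.
have SE i j : ev (S i j) = ev (J (r (enum_val i)) (c (enum_val j))) by rewrite mxE.
have detS : \det S != 0.
  suff: ev (\det S) != 0 by apply: contra_neq => ->; rewrite rmorph0.
  rewrite -det_map_mx det_trig; last first.
    apply/is_trig_mxP => i j ltij; rewrite mxE SE off0 // (inj_eq enum_val_inj).
    by rewrite -val_eqE ltn_eqF.
  by apply/prodf_neq0 => i _; rewrite mxE SE diag0.
apply: leq_trans (rank_mxsub_le r' c' _).
rewrite -map_mxsub -/S mxrank_unit // unitmxE det_map_mx unitfE.
by rewrite tofrac_eq0.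
Qed.

Section Rank.

Variables (k : fieldType) (m' q : nat).
Local Notation m := m'.+1.
Local Notation n := (m + q)%N.
Local Notation X := (generic_mx k n m).

Definition base_cols : m.-tuple 'I_n := [tuple lshift q c | c < m].

(** The first [m] columns with column [a] replaced by column [m + j]; the new
column comes last, so that the selection is increasing. *)
Definition exchange_cols (a : 'I_m) (j : 'I_q) : m.-tuple 'I_n :=
  [tuple if unlift ord_max c is Some d then lshift q (lift a d) else rshift m j
  | c < m].

Lemma base_cols_sel : base_cols \in col_sel n m.
Proof. by apply: col_sel_ltn => c d ltcd; rewrite !tnth_mktuple. Qed.

Lemma exchange_cols_sel a j : exchange_cols a j \in col_sel n m.
Proof.
apply: col_sel_ltn => c d ltcd; rewrite !tnth_mktuple.
case: unliftP ltcd => [c' ->|->]; case: unliftP => [d' ->|->] /=.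
- rewrite /bump; lia.
- by have := ltn_ord c'; rewrite /bump; lia.
- by case: d' => d' /= ltd; rewrite /bump; lia.
- by rewrite ltnn.
Qed.

Local Notation ev := (specialize idfun (row_mx 1%:M 0 : 'M[k]_(m, n))).

Lemma ev_mderiv_minor (t : m.-tuple 'I_n) a b :
  ev (minor k t)^`M(mxvec_index a b) =
  \sum_(c | tnth t c == b) cofactor (colsub (tnth t) (row_mx 1%:M 0)) a c.
Proof.
rewrite mderiv_minor raddf_sum; apply: eq_bigr => c _.
by rewrite -[LHS]cofactor_map_mx map_mxsub specialize_generic.
Qed.

Lemma colsub_base (R : comNzRingType) (M : 'M[R]_(m, n)) :
  colsub (tnth base_cols) M = lsubmx M.
Proof. by apply/matrixP => i j; rewrite !mxE tnth_mktuple. Qed.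

(** The selected columns of [(1 | 0)] are the unit vectors other than the [a]-th,
followed by a zero column. *)
Lemma cofactor_exchange (a a' : 'I_m) (j : 'I_q) c :
  cofactor (colsub (tnth (exchange_cols a j)) (row_mx 1%:M 0 : 'M[k]_(m, m + q)))
     a' c
  = if (c == ord_max) && (a' == a) then (-1) ^+ (a + m') else 0.
Proof.
set M := colsub _ _.
have ME i d : M i d = if unlift ord_max d is Some e then (i == lift a e)%:R else 0.
  rewrite !mxE tnth_mktuple; case: unlift => [e|].
    by rewrite (unsplitK (inl _)) mxE.
  by rewrite (unsplitK (inr _)) mxE.
clearbody M; have [->{c}|neqc] := eqVneq c ord_max; last first.
  have [e eqm _] := unlift_some neqc.
  (* Deleting another column leaves the last one, which is zero. *)
  rewrite /cofactor (expand_det_col _ e) big1 ?mulr0 // => i _.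
  by rewrite !mxE ME -eqm unlift_none mul0r.
have M'E i d : row' a' (col' ord_max M) i d = (lift a' i == lift a d)%:R.
  by rewrite !mxE ME liftK.
have [eqa|neqa] := eqVneq a' a.
  rewrite eqa in M'E *; rewrite /cofactor (_ : row' _ _ = 1%:M) ?det1 ?mulr1 //.
  by apply/matrixP => i d; rewrite M'E mxE (inj_eq lift_inj).
have [e eqa _] := unlift_some neqa.
(* Row [a] meets none of the remaining unit vectors. *)
rewrite /cofactor (expand_det_row _ e) big1 ?mulr0 // => d _.
by rewrite M'E -eqa (negPf (neq_lift _ _)) mul0r.
Qed.

(** The exchange minor for [(a, j)] is paired with the variable in row [a] and
column [m + j], and the first minor with the top left variable. *)
Lemma rank_jacobian_ge :
  ((m * q).+1 <= \rank (map_mx (@tofrac _) (jacobian_minors k n m)))%N.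
Proof.
have -> : (m * q).+1 = #|{: option ('I_m * 'I_q)}|.
  by rewrite card_option card_prod !card_ord.
pose sel (u : option ('I_m * 'I_q)) :=
  if u is Some (a, j) then exchange_cols a j else base_cols.
pose var (u : option ('I_m * 'I_q)) : 'I_(m * n) :=
  if u is Some (a, j) then mxvec_index a (rshift m j)
  else mxvec_index ord0 (lshift q ord0).
pose row u := enum_rank_in base_cols_sel (sel u).
have rowE u v : jacobian_minors k n m (row u) v = (minor k (sel u))^`M(v).
  rewrite mxE enum_rankK_in //; case: u => [[a j]|].
    exact: exchange_cols_sel.
  exact: base_cols_sel.
apply: (rank_ge_diagonal_specialization (ev := ev) (r := row) (c := var)).
- case=> [[a j]|] /=; rewrite rowE ev_mderiv_minor.
    rewrite (bigD1 ord_max) /= ?tnth_mktuple ?unlift_none //.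
    rewrite cofactor_exchange !eqxx big1 ?addr0 ?signr_eq0 //.
    by move=> c /andP[_ /negPf nc]; rewrite cofactor_exchange nc.
  rewrite (big_pred1 ord0) => [|c]; last first.
    by rewrite tnth_mktuple (inj_eq (@lshift_inj _ _)).
  rewrite colsub_base row_mxKl.
  have := adj1 k m => /matrixP/(_ 0 0); rewrite !mxE => ->.
  by rewrite oner_eq0.
- move=> u v; rewrite rowE; case: u v => [[a j]|] [[a' j']|] //= neq;
    rewrite ev_mderiv_minor big1 // => c /eqP.
  + rewrite cofactor_exchange; case: andP => // -[/eqP-> /eqP eqa].
    rewrite tnth_mktuple unlift_none => /rshift_inj eqj.
    by rewrite eqa eqj eqxx in neq.
  + rewrite cofactor_exchange; case: andP => // -[/eqP-> _].
    by rewrite tnth_mktuple unlift_none => /eqP; rewrite eq_rlshift.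
  + by rewrite tnth_mktuple => /eqP; rewrite eq_lrshift.
Qed.

Lemma det_base_minor_neq0 : \det (lsubmx X) != 0.
Proof.
rewrite -colsub_base -[\det _]/(minor k base_cols).
apply: contra_neq (oner_neq0 k) => d0.
have := congr1 ev d0; rewrite rmorph0 specialize_minor colsub_base row_mxKl.
by rewrite det1.
Qed.

Local Notation X' := (map_mx (@tofrac _) X).

Lemma base_block_unit : lsubmx X' \in unitmx.
Proof.
by rewrite unitmxE -map_lsubmx det_map_mx unitfE tofrac_eq0 det_base_minor_neq0.
Qed.

Lemma rank_jacobian_le :
  (\rank (map_mx (@tofrac _) (jacobian_minors k n m)) <= (m * q).+1)%N.
Proof.
pose L := lin_mulmxr (m := m) X.
have rankL : \rank (map_mx (@tofrac _) L)^T = (m * m)%N.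
  have -> : map_mx (@tofrac _) L = lin_mulmxr X'.
    by apply: map_lin_mx => M; rewrite map_mxM.
  rewrite mxrank_tr; apply/eqP/inj_row_free => v.
  rewrite mul_rV_lin => /(congr1 vec_mx); rewrite mxvecK raddf0 /= => vX0.
  apply: (can_inj vec_mxK); rewrite raddf0.
  rewrite -[LHS](mulmxK base_block_unit) (_ : _ *m lsubmx X' = 0) ?mul0mx //.
  by rewrite mulmx_lsub vX0 raddf0.
have le1 : (\rank (map_mx (@tofrac _) (jacobian_minors k n m)
                    *m (map_mx (@tofrac _) L)^T) <= 1)%N.
  by rewrite map_trmx -map_mxM jacobian_mul_row_operations map_mxM mulmx_max_rank.
have := leq_trans (mxrank_mul_min _ _) le1; rewrite rankL; nia.
Qed.

Lemma rank_jacobian :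
  \rank (map_mx (@tofrac _) (jacobian_minors k n m)) = (m * q).+1.
Proof. by apply/eqP; rewrite eqn_leq rank_jacobian_le rank_jacobian_ge. Qed.

End Rank.

(** * The Grassmann algebra *)

Section KernelPrime.

Variables (R : nzRingType) (S : idomainType) (f : {rmorphism R -> S}).

Definition ker_rmorph : R -> bool := fun x => f x == 0.

Fact ker_rmorph_idealr : idealr_closed (ker_rmorph : {pred R}).
Proof.
split; rewrite ?unfold_in /ker_rmorph ?rmorph0 ?rmorph1 ?oner_eq0 //.
move=> a u v; rewrite !unfold_in => /eqP fu /eqP fv.
by rewrite rmorphD rmorphM fu fv mulr0 addr0.
Qed.

Fact ker_rmorph_prime : prime_idealr_closed (ker_rmorph : {pred R}).
Proof. by move=> u v; rewrite !unfold_in /ker_rmorph rmorphM mulf_eq0. Qed.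

HB.instance Definition _ := isIdealr.Build R ker_rmorph ker_rmorph_idealr.
HB.instance Definition _ :=
  isPrimeIdealrClosed.Build R ker_rmorph ker_rmorph_prime.

Definition kernel_prime : prime_idealr R := ker_rmorph.

Lemma mem_kernel_prime x : (x \in kernel_prime) = (f x == 0).
Proof. by []. Qed.

End KernelPrime.

Lemma kernel_prime_sub (R : nzRingType) (S : idomainType)
    (f g : {rmorphism R -> S}) :
  (forall x, f x = 0 -> g x = 0) -> {subset kernel_prime f <= kernel_prime g}.
Proof. by move=> fg x; rewrite !mem_kernel_prime => /eqP/fg/eqP. Qed.

(** The elements on which two homomorphisms agree form a subalgebra. *)
Lemma gen_subalg_ext (R : comNzRingType) (A : comAlgType R) (T : nzRingType)
    (f g : {rmorphism A -> T}) (S : {pred A}) :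
  (forall c, f c%:A = g c%:A) -> {in S, f =1 g} -> {in gen_subalg S, f =1 g}.
Proof.
move=> fgC fgS x /gen_subalgP Sx; apply/eqP.
apply: (Sx [pred x | f x == g x]) => [|y /fgS/eqP //].
split=> [|a u v|u v]; rewrite !inE ?rmorph1 //= => /eqP fu /eqP fv.
  by rewrite -mulr_algl !rmorphD !rmorphM fgC fu fv.
by rewrite !rmorphM fu fv.
Qed.

Section Grassmann.

Variables (k : fieldType) (n m : nat).
Local Notation G := (grassmann_algebra k n m).
Local Notation minors := [pred p | p \in [seq minor k t | t in col_sel n m]].

(** The inclusion, under a name that exposes the polynomial ring as its codomain
to the inference of morphism structures. *)
Definition grassmann_val : G -> {mpoly k[m * n]} := val.
HB.instance Definition _ := GRing.RMorphism.on grassmann_val.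

Lemma grassmann_val_inj : injective grassmann_val.
Proof. exact: val_inj. Qed.

Lemma minor_in_grassmann (t : m.-tuple 'I_n) :
  t \in col_sel n m -> exists x : G, grassmann_val x = minor k t.
Proof.
move=> tP; have Gt : minor k t \in gen_subalg minors.
  by apply: sub_gen_subalg; rewrite inE; apply: image_f.
by exists (GenSubalg Gt).
Qed.

Lemma grassmann_ext (T : nzRingType) (f g : {rmorphism {mpoly k[m * n]} -> T}) :
  (forall c, f c%:MP = g c%:MP) -> (forall t, f (minor k t) = g (minor k t)) ->
  forall x : G, f (grassmann_val x) = g (grassmann_val x).
Proof.
move=> fgC fgt [x Gx]; apply: (gen_subalg_ext _ _ Gx) => [c|y].
  by rewrite -mul_mpolyC mulr1.
by rewrite inE => /imageP[t _ ->].
Qed.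

Fact grassmann_const_subproof (c : k) :
  c%:MP \in gen_subalg (A := {mpoly k[m * n]}) minors.
Proof.
have [G1 GZ _] := gen_subalg_closed (A := {mpoly k[m * n]}) minors.
by rewrite -[c%:MP]mulr1 mul_mpolyC -[_ *: _]addr0 GZ ?rpred0.
Qed.

Definition grassmann_const (c : k) : G := GenSubalg (grassmann_const_subproof c).

Fact grassmann_const_zmod : zmod_morphism grassmann_const.
Proof. by move=> c d; apply: grassmann_val_inj; rewrite rmorphB; exact: mpolyCB. Qed.

Fact grassmann_const_monoid : monoid_morphism grassmann_const.
Proof.
split=> [|c d]; apply: grassmann_val_inj; rewrite ?rmorph1 ?rmorphM //.
exact: mpolyCM.
Qed.

HB.instance Definition _ :=
  GRing.isZmodMorphism.Build k G grassmann_const grassmann_const_zmod.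
HB.instance Definition _ :=
  GRing.isMonoidMorphism.Build k G grassmann_const grassmann_const_monoid.

End Grassmann.

(** * A maximal chain of staircases *)

Section SchubertCorner.

Variables (m' q : nat).
Local Notation m := m'.+1.

(** The column of the corner in row [i] after [s] moves. Starting on the
diagonal, the last row moves [q] cells to the right, then the row above, and so
on. The top row is allowed one cell more, so that at step [m * q + 1] the
columns up to [q] are zero, and with them all maximal minors. *)
Definition corner (s i : nat) : nat :=
  (i + minn (q + (i == 0)) (s - (m' - i) * q))%N.

Lemma corner_mono s s' i : (s <= s')%N -> (corner s i <= corner s' i)%N.
Proof. by rewrite /corner; lia. Qed.

Lemma corner_strict s i j :
  (s <= m * q)%N -> (i < j)%N -> (corner s i < corner s j)%N.
Proof.
move=> les ltij; rewrite /corner -addSn leq_add //.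
have : ((m' - j) * q <= (m' - i) * q)%N by rewrite leq_mul2r; lia.
case: i ltij => [|i] ltij; last by case: j ltij => //; lia.
by rewrite subn0; move: les; rewrite mulSn; case: j ltij => // j _; lia.
Qed.

Lemma corner_bound s i : (s <= m * q)%N -> (i < m)%N -> (corner s i < m + q)%N.
Proof.
rewrite /corner mulSn; case: i => [|i]; last by lia.
by rewrite subn0; lia.
Qed.

Lemma corner_step s : (s <= m * q)%N ->
  exists i : 'I_m, (corner s i < corner s.+1 i)%N.
Proof.
rewrite leq_eqVlt => /orP[/eqP->|lts].
  by exists ord0; rewrite /corner /= subn0 mulSn; lia.
have q0 : (0 < q)%N by case: (q) lts => //; rewrite muln0.
(* The row on the move is the [s %/ q]-th from the bottom. *)
have ltd : (s %/ q < m)%N by rewrite ltn_divLR.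
exists (rev_ord (Ordinal ltd)); rewrite /corner /=.
rewrite subSS subKn //.
have := divn_eq s q; have := ltn_pmod s q0.
by move: (s %/ q * q)%N (s %% q)%N (_ - _ == 0)%N => a r b; lia.
Qed.

End SchubertCorner.

Section PrimeChain.

Variables (k : fieldType) (m' q : nat).
Local Notation m := m'.+1.
Local Notation n := (m + q)%N.
Local Notation X := (generic_mx k n m).

Definition staircase_mx (s : nat) : 'M[{mpoly k[m * n]}]_(m, n) :=
  \matrix_(i, j) if (j < corner m' q s i)%N then 0 else X i j.

Local Notation spec s := (specialize (@mpolyC (m * n) k) (staircase_mx s)).

(** The matrix of a larger staircase is a specialization of that of a smaller
one, whence the inclusion of the kernels. *)
Lemma spec_staircase s s' : (s <= s')%N ->
  map_mx (spec s') (staircase_mx s) = staircase_mx s'.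
Proof.
move=> les; apply/matrixP => i j; rewrite mxE [staircase_mx s i j]mxE.
have [ltj|lej] := ltnP.
  rewrite rmorph0 mxE ifT //.
  by apply: leq_trans ltj _; apply: corner_mono.
have /matrixP/(_ i j) <- := specialize_generic (@mpolyC (m * n) k) (staircase_mx s').
by rewrite [RHS]mxE.
Qed.

Lemma spec_spec s s' (x : grassmann_algebra k n m) : (s <= s')%N ->
  spec s' (spec s (grassmann_val x)) = spec s' (grassmann_val x).
Proof.
move=> les; apply: (grassmann_ext (f := spec s' \o spec s)) => [c|t] /=.
  by rewrite !specializeC.
by rewrite !specialize_minor -det_map_mx map_mxsub spec_staircase.
Qed.

(** For [s <= m * q] the corners lie inside the matrix, and [inord] returns the
column it is given. *)
Definition corner_cols (s : nat) : m.-tuple 'I_n :=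
  [tuple (inord (corner m' q s i) : 'I_(m' + q).+1) | i < m].

Lemma tnth_corner_cols s i : (s <= m * q)%N ->
  tnth (corner_cols s) i = corner m' q s i :> nat.
Proof.
by move=> les; rewrite tnth_mktuple inordK //; apply: (corner_bound les).
Qed.

Lemma corner_cols_sel s : (s <= m * q)%N -> corner_cols s \in col_sel n m.
Proof.
move=> les; apply: col_sel_ltn => c d ltcd.
by rewrite !tnth_corner_cols // corner_strict.
Qed.

(** On the corner columns of a staircase, its matrix and those of all later
staircases are upper triangular. *)
Lemma spec_corner_minor s s' : (s <= m * q)%N -> (s <= s')%N ->
  spec s' (minor k (corner_cols s)) =
  \prod_(i < m) staircase_mx s' i (tnth (corner_cols s) i).
Proof.
move=> les less'; rewrite specialize_minor -det_tr det_trig.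
  by apply: eq_bigr => i _; rewrite mxE mxE.
apply/is_trig_mxP => i j ltij; rewrite 3!mxE ifT // tnth_corner_cols //.
by apply: leq_trans (corner_strict les ltij) _; apply: corner_mono.
Qed.

Lemma corner_minor_neq0 s : (s <= m * q)%N -> spec s (minor k (corner_cols s)) != 0.
Proof.
move=> les; rewrite spec_corner_minor //; apply/prodf_neq0 => i _.
by rewrite mxE tnth_corner_cols // ltnn mxE -msize_poly_eq0 msizeX.
Qed.

Lemma corner_minor_eq0 s s' : (s <= m * q)%N -> (s < s')%N ->
  spec s' (minor k (corner_cols s)) = 0.
Proof.
move=> les ltss'; rewrite spec_corner_minor ?(ltnW ltss') //.
have [i lti] := corner_step les; rewrite (bigD1 i) //= mxE ifT ?mul0r //.
by rewrite tnth_corner_cols //; apply: leq_trans lti _; apply: corner_mono.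
Qed.

Definition schubert_prime (s : nat) : prime_idealr (grassmann_algebra k n m) :=
  kernel_prime (spec s \o @grassmann_val k n m).

Lemma schubert_chain :
  prime_chain (fun s : 'I_(m * q).+2 => schubert_prime s).
Proof.
move=> i j ltij; have lei : (i <= m * q)%N by have := ltn_ord j; lia.
split.
  apply: kernel_prime_sub => x /= xi; rewrite -(spec_spec x (ltnW ltij)).
  have {}xi : spec i (grassmann_val x) = 0 := xi.
  by rewrite xi rmorph0.
have [x xE] := minor_in_grassmann k (corner_cols_sel lei).
exists x; rewrite mem_kernel_prime /= xE.
  by rewrite corner_minor_eq0.
exact: corner_minor_neq0.
Qed.

End PrimeChain.

(** * Parameters for the Grassmann algebra *)

Section Embedding.

Variables (k : fieldType) (m' q : nat).
Local Notation m := m'.+1.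
Local Notation n := (m + q)%N.
Local Notation X := (generic_mx k n m).
Local Notation params := (option ('I_m * 'I_q)).
Local Notation D := #|{: params}|.
Local Notation K := {fraction {mpoly k[m * n]}}.
Local Notation X' := (map_mx (@tofrac {mpoly k[m * n]}) X).

(** [(1 | Y)] with its first row scaled by [t], where [t] and [Y] are the entries
of [y]: the scaling multiplies all maximal minors by [t]. *)
Definition param_mx (S : comNzRingType) (y : params -> S) : 'M[S]_(m, n) :=
  diag_mx (\row_i if i == 0 then y None else 1)
  *m row_mx 1%:M (\matrix_(i, j) y (Some (i, j))).

Lemma eq_param_mx (S : comNzRingType) (y z : params -> S) :
  y =1 z -> param_mx y = param_mx z.
Proof.
move=> yz; rewrite /param_mx; congr (diag_mx _ *m row_mx _ _).
  by apply/rowP => i; rewrite !mxE yz.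
by apply/matrixP => i j; rewrite !mxE yz.
Qed.

Lemma map_param_mx (S T : comNzRingType) (f : {rmorphism S -> T}) (y : params -> S) :
  map_mx f (param_mx y) = param_mx (f \o y).
Proof.
rewrite map_mxM map_diag_mx map_row_mx map_mx1; congr (diag_mx _ *m row_mx _ _).
  by apply/rowP => i; rewrite !mxE; case: ifP => // _; rewrite rmorph1.
by apply/matrixP => i j; rewrite !mxE.
Qed.

Lemma det_colsub_param_mx (S : comNzRingType) (y : params -> S) (t : m.-tuple 'I_n) :
  \det (colsub (tnth t) (param_mx y)) =
  y None * \det (colsub (tnth t) (row_mx 1%:M (\matrix_(i, j) y (Some (i, j))))).
Proof.
rewrite -mulmx_colsub det_mulmx det_diag; congr (_ * _).
by rewrite (bigD1 0) //= mxE eqxx big1 ?mulr1 // => i /negPf ni; rewrite mxE ni.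
Qed.

(** The values of the parameters at [X = (A | B)], namely [\det A] and [A^-1 B]. *)
Definition chart (u : params) : K :=
  if u is Some (i, j) then (invmx (lsubmx X') *m rsubmx X') i j
  else \det (lsubmx X').

(** The matrices [X] and [param_mx chart] differ only by a row operation of
determinant one, so they have the same maximal minors. *)
Lemma det_colsub_chart (t : m.-tuple 'I_n) :
  \det (colsub (tnth t) (param_mx chart)) = tofrac (minor k t).
Proof.
rewrite det_colsub_param_mx /= -det_mulmx mulmx_colsub -det_map_mx map_mxsub.
congr (\det (colsub _ _)); rewrite mul_mx_row mulmx1.
rewrite (_ : \matrix_(i, j) _ = invmx (lsubmx X') *m rsubmx X'); last first.
  by apply/matrixP => i j; rewrite mxE.
by rewrite mulmxA mulmxV ?base_block_unit // mul1mx hsubmxK.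
Qed.

Definition coord (u : params) : {mpoly k[D]} := 'X_(enum_rank u).

Definition embed : grassmann_algebra k n m -> {mpoly k[D]} :=
  specialize (@mpolyC D k) (param_mx coord) \o @grassmann_val k n m.
HB.instance Definition _ := GRing.RMorphism.on embed.

Lemma embed_const c : embed (grassmann_const n m c) = c%:MP.
Proof. exact: specializeC. Qed.

Definition eval_chart : {mpoly k[D]} -> K :=
  mmap (@tofrac _ \o @mpolyC (m * n) k) (chart \o enum_val).
HB.instance Definition _ := GRing.RMorphism.on eval_chart.

(** Evaluating the parameters at the generic matrix recovers the minors, hence all
of [G]. *)
Lemma embedK x : eval_chart (embed x) = tofrac (grassmann_val x).
Proof.
apply: (grassmann_ext
  (f := eval_chart \o specialize (@mpolyC D k) (param_mx coord))) => [c|t] /=.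
  by rewrite specializeC /eval_chart mmapC.
rewrite specialize_minor -det_map_mx map_mxsub map_param_mx -det_colsub_chart.
congr (\det (colsub _ _)); apply: eq_param_mx => u.
by rewrite /= /eval_chart mmapX mmap1U /= enum_rankK.
Qed.

Lemma embed_inj : injective embed.
Proof.
move=> x y /(congr1 eval_chart); rewrite !embedK => /eqP.
by rewrite tofrac_eq => /eqP/grassmann_val_inj.
Qed.

Lemma has_krull_dim_grassmann : has_krull_dim (grassmann_algebra k n m) (m * q).+1.
Proof.
split; first by exists (fun s => schubert_prime k m' q s); apply: schubert_chain.
move=> l P chP; have -> : (m * q).+1 = D by rewrite card_option card_prod !card_ord.
exact: (prime_chain_subpolynomial embed_inj embed_const chP).
Qed.

End Embedding.

Theorem theorem1p15 (k : fieldType) (n m : nat) (hm : (1 <= m)%N) (hmn : (m <= n)%N) :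
  has_krull_dim (grassmann_algebra k n m)
    (\rank (map_mx (@tofrac {mpoly k[m * n]}) (jacobian_minors k n m))).
Proof.
rewrite -(subnKC hmn); case: m hm {hmn} => // m' _.
by rewrite rank_jacobian; apply: has_krull_dim_grassmann.
Qed.
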